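(* Let the pairs $\{(X_i,Y_i): i\in D^{cal}\cup D^{test}\}$ be exchangeable, and let the fitted scores $S^1,S^2$ follow the two-class mixture model described in the context. Assume there exist $x_0\ne x_1$ such that $F^1_1(x_0)\ne F^2_1(x_0)$ and $F^1_1(x_1)\neq F^2_1(x_1)$. Then, for a given level $\alpha$, the selective classification rule $$\hat Y_j=\Big(\arg\max_{i\in\{1,2\}} S^i(X_j)\Big)\cdot\mathbb I(\hat R_j\le\alpha),\qquad j\in D^{test},$$ with R-values $\hat R_j$ defined in the context, controls the false selection rate at level $\alpha$, i.e. $$\mathrm{FSR}=\mathbb E\left\{\frac{\sum_{j\in D^{test}}\mathbb I(\hat Y_j\ne Y_j,\hat Y_j\ne0)}{\big(\sum_{j\in D^{test}}\mathbb I(\hat Y_j\neq0)\big)\vee1}\right\}\le\alpha .$$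
   Context: Binary selective classification. Samples are pairs $(X,Y)$ with $X\in\mathbb R^p$ and true class $Y\in\{1,2\}$. Labeled data $D$ are randomly split into $D^{train}$ and $D^{cal}$ (the latter of size $n^{cal}$); $D^{test}$ is a test set of size $n^{test}$ with unobserved labels; $i\in D^{cal}$ or $i\in D^{test}$ means that sample $i$ belongs to that set. A prediction $\hat Y=0$ means ''indecision''. A black-box model is trained only on $D^{train}$ and yields score functions $S^1(x),S^2(x)$ for classes 1 and 2 with $S^1(x)+S^2(x)=1$ (not necessarily true class probabilities). Let $\hat S_i=\max\{S^1(X_i),S^2(X_i)\}$. Mixture model: in the test data $S^i\sim \pi_{test}F^i_1+(1-\pi_{test})F^i_2$ and in the calibration data $S^i\sim\pi_{cal}F^i_1+(1-\pi_{cal})F^i_2$, $i=1,2$, where $\pi_{test},\pi_{cal}$ are the probabilities of class 1 in the test and calibration data, and $F^j_k$ is the conditional CDF of $S^j(X)$ given $Y=k$, with density $f^j_k$. Here $\pi_{test}=\pi_{cal}$. For a threshold $t$ define $$\hat Q(t)=\frac{\frac1{n^{cal}+1}\Big\{\sum_{i\in D^{cal}}\mathbb I\big(\hat S_i\ge t,\ \arg\max_{k} S^k(X_i)\ne Y_i\big)+1\Big\}}{\frac1{n^{test}}\Big\{\big(\sum_{j\in D^{test}}\mathbb I(\hat S_j\ge t)\big)\vee1\Big\}},$$ and for $j\in D^{test}$ the R-value $\hat R_j=\inf_{t\le\hat S_j}\hat Q(t)$. Equivalently, with $\tau=\inf\{t:\hat Q(t)\le\alpha\}$, a class is assigned to sample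 $j$ when its score $\hat S_j$ reaches the threshold $\tau$. Here $a\vee b=\max(a,b)$.
   Formalization: Exchangeability of the calibration and test pairs is assumed jointly with (conditionally on) the training data that determine the scores; exchangeability of those pairs alone, with scores depending on correlated training data, does not suffice for the bound. *)

(* Defs.v *)
(* MathComp-Analysis *)
From HB Require Import structures.
From mathcomp Require Import all_boot all_order all_algebra all_fingroup.
From mathcomp Require Import all_classical all_reals all_analysis.

Set Implicit Arguments.
Unset Strict Implicit.
Unset Printing Implicit Defensive.

Import Order.TTheory GRing.Theory Num.Theory.
Import numFieldNormedType.Exports.

Local Open Scope classical_set_scope.
Local Open Scope ring_scope.

Section selective_classification.
Context {R : realType} {p : nat}.

(* Classes are the naturals 1 and 2, and 0 stands for "indecision"; a family
   indexed by a class or a score, such as [s : nat -> _], is only ever used at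
   the indices 1 and 2.  R^p is [p.-tuple R] with the product sigma-algebra.  *)

(* A tie is broken in favour of class 1; ties have probability 0 when the
   scores have a density.  *)
Definition argmax_class (s : nat -> p.-tuple R -> R) (x : p.-tuple R) : nat :=
  if s 2%N x <= s 1%N x then 1%N else 2%N.

Definition max_score (s : nat -> p.-tuple R -> R) (x : p.-tuple R) : R :=
  Num.max (s 1%N x) (s 2%N x).

Context {ncal ntest : nat}.

(* The definitions below are for one realization of the data: [s] is the pair
   of fitted score functions, [xcal], [ycal] the labeled calibration sample,
   [xtest] the test features and [ytest] the unobserved test labels.  *)

Definition Qhat (s : nat -> p.-tuple R -> R)
    (xcal : 'I_ncal -> p.-tuple R) (ycal : 'I_ncal -> nat)
    (xtest : 'I_ntest -> p.-tuple R) (t : R) : R :=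
  (ncal.+1%:R^-1 *
     (\sum_(i < ncal) ((t <= max_score s (xcal i))%R &&
                       (argmax_class s (xcal i) != ycal i)) + 1)%N%:R) /
  (ntest%:R^-1 *
     (maxn (\sum_(j < ntest) (t <= max_score s (xtest j))%R) 1)%:R).

Definition Rvalue (s : nat -> p.-tuple R -> R)
    (xcal : 'I_ncal -> p.-tuple R) (ycal : 'I_ncal -> nat)
    (xtest : 'I_ntest -> p.-tuple R) (j : 'I_ntest) : R :=
  inf [set Qhat s xcal ycal xtest t |
        t in [set t : R | t <= max_score s (xtest j)]].

Definition Yhat (alpha : R) (s : nat -> p.-tuple R -> R)
    (xcal : 'I_ncal -> p.-tuple R) (ycal : 'I_ncal -> nat)
    (xtest : 'I_ntest -> p.-tuple R) (j : 'I_ntest) : nat :=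
  (argmax_class s (xtest j) * (Rvalue s xcal ycal xtest j <= alpha)%R)%N.

Definition false_selection_proportion (yhat ytest : 'I_ntest -> nat) : R :=
  (\sum_(j < ntest) ((yhat j != ytest j) && (yhat j != 0)))%N%:R /
  (maxn (\sum_(j < ntest) (yhat j != 0)) 1)%:R.

End selective_classification.

Section probabilistic_model.
Context {R : realType} {d : measure_display} {Omega : measurableType d}.
Variable P : probability Omega R.

(* Exchangeability of [Z] jointly with, equivalently conditionally on, the
   random element [G]; with a constant [G] this is plain exchangeability.  *)
Definition exchangeable_given {dG dV : measure_display}
    {TG : measurableType dG} {V : measurableType dV} {n : nat}
    (G : Omega -> TG) (Z : 'I_n -> Omega -> V) : Prop :=
  forall (sigma : 'S_n) (U : set (TG * n.-tuple V)), measurable U ->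
    pushforward P (fun w => (G w, [tuple Z (sigma i) w | i < n])) U =
    pushforward P (fun w => (G w, [tuple Z i w | i < n])) U.

(* P(V <= x | E); meaningful only if P(E) > 0.  *)
Definition cond_cdf (E : set Omega) (V : Omega -> R) (x : R) : R :=
  fine (P ([set w | V w <= x] `&` E)) / fine (P E).

Definition cdf_with_density (F f : R -> R) : Prop :=
  [/\ measurable_fun [set: R] f,
      forall y, 0 <= f y,
      (\int[lebesgue_measure]_y (f y)%:E = 1)%E &
      forall x, (\int[lebesgue_measure]_(y in [set y : R | (y <= x)%R]) (f y)%:E
                 = (F x)%:E)%E].

(* [Y i w] is the label of sample [i], [V j i w] its [j]-th fitted score and
   [F j k] the conditional CDF of the [j]-th score given class [k].  *)
Definition two_class_mixture {n : nat} (Y : 'I_n -> Omega -> nat)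
    (V : nat -> 'I_n -> Omega -> R) (pi : R) (F : nat -> nat -> R -> R) : Prop :=
  0 <= pi <= 1 /\
  forall i : 'I_n,
    P [set w | Y i w = 1%N] = pi%:E /\
    forall j : nat, j \in [:: 1; 2]%N ->
      (forall x, P [set w | V j i w <= x] =
                 (pi * F j 1%N x + (1 - pi) * F j 2%N x)%:E) /\
      (forall k : nat, k \in [:: 1; 2]%N -> (0 < P [set w | Y i w = k])%E ->
         forall x, F j k x = cond_cdf [set w | Y i w = k] (V j i) x).

End probabilistic_model.

(* Main.v *)
(* Fix a test point j and swap it in turn with itself and with each of the ncal
   calibration points.  If two of these ncal + 1 arrangements put an error at
   place j that is selected, they have the same threshold: below the smaller of
   the two thresholds both errors count, wherever they sit, so Qhat takes the
   same values there.  The K arrangements in which j is a false selection thus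
   share the threshold t and the number N of selections, and since at least
   K - 1 calibration points are errors above t, Qhat(t) <= alpha gives
   K / N <= alpha (ncal + 1) / ntest.  By exchangeability the arrangements have
   the same law, so the expected share of j in the false selection proportion
   is at most alpha / ntest; sum over j.  *)

Require Import Defs.
From HB Require Import structures.
From mathcomp Require Import all_boot all_order all_algebra all_fingroup.
From mathcomp Require Import all_classical all_reals all_analysis.
From mathcomp Require Import measurable_realfun.

Set Implicit Arguments.
Unset Strict Implicit.
Unset Printing Implicit Defensive.

Import Order.TTheory GRing.Theory Num.Theory.
Import numFieldNormedType.Exports.

Local Open Scope classical_set_scope.
Local Open Scope ring_scope.

Lemma sum_option (T : finType) (F : option T -> nat) :
  (\sum_o F o = F None + \sum_x F (Some x))%N.
Proof.
rewrite (bigD1 None)//= (reindex_omap Some id)/=; last by case.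
by congr addn; apply: eq_bigl => x; rewrite eqxx.
Qed.

(** * Selection for fixed scores and error indicators *)

Section scored_sample.
Context {R : realType} {ncal ntest : nat}.
Variable alpha : R.
Implicit Types (s : 'I_(ncal + ntest) -> R) (e : 'I_(ncal + ntest) -> bool).

(* [Qhat], with the data reduced to the maximal scores [s] and the
   misclassification indicators [e].  *)
Definition false_prop s e (t : R) : R :=
  (ncal.+1%:R^-1 *
     (\sum_(i < ncal) ((t <= s (lshift ntest i))%R && e (lshift ntest i)) + 1)%N%:R) /
  (ntest%:R^-1 * (maxn (\sum_(j < ntest) (t <= s (rshift ncal j))%R) 1)%:R).

(** Thresholds range only over the sample scores, calibration and test together, so selection is a
    Boolean; [inf_false_prop_le] matches it with the infimum over all real thresholds. *)
Definition selected s e (j : 'I_ntest) : bool :=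
  [exists i, (s i <= s (rshift ncal j)) && (false_prop s e (s i) <= alpha)].

Definition num_selected s e : nat := \sum_(j < ntest) selected s e j.

Definition false_share s e (j : 'I_ntest) : R :=
  (selected s e j && e (rshift ncal j))%:R / (maxn (num_selected s e) 1)%:R.

Lemma false_prop_ge0 s e t : 0 <= false_prop s e t.
Proof. by rewrite /false_prop divr_ge0// mulr_ge0. Qed.

(** [false_prop] is a step function that jumps only at scores: raising [t] to the least score above
    it changes no comparison. The index [k] guarantees that such a score exists. *)
Lemma false_prop_attained s e t k : t <= s k ->
  exists i, [/\ t <= s i, s i <= s k & false_prop s e (s i) = false_prop s e t].
Proof.
move=> tk; case: (Order.TotalTheory.arg_minP s (i0 := k) (P := fun i => t <= s i) tk).
move=> i ti imin; exists i; split; [by []|exact: imin|].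
have tE l : (s i <= s l) = (t <= s l).
  by apply/idP/idP => [|/imin//]; apply: le_trans.
rewrite /false_prop; congr (_ * (_ + _)%N%:R / (_ * (maxn _ _)%:R)).
  by apply: eq_bigr => l _; rewrite tE.
by apply: eq_bigr => l _; rewrite tE.
Qed.

Lemma selectedP s e j :
  reflect (exists2 t, t <= s (rshift ncal j) & false_prop s e t <= alpha)
    (selected s e j).
Proof.
apply: (iffP existsP) => [[i /andP[ij Qi]]|[t tj Qt]]; first by exists (s i).
have [i [_ ij Qi]] := false_prop_attained e tj.
by exists i; rewrite ij Qi.
Qed.

(** The threshold is a witness [t] for the selected test point of smallest score: every selected
    point scores at least as high, and [t] itself witnesses the selection of every point above
    it. *)
Lemma selected_threshold s e j : selected s e j ->
  exists t, [/\ t <= s (rshift ncal j), false_prop s e t <= alpha &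
                forall l, selected s e l = (t <= s (rshift ncal l))].
Proof.
move=> selj.
case: (Order.TotalTheory.arg_minP (fun l => s (rshift ncal l)) (P := selected s e) selj).
move=> k /selectedP[t tk Qt] kmin; exists t; split=> //.
  exact: le_trans (kmin _ selj).
move=> l; apply/idP/idP => [/kmin|tl]; first exact: le_trans.
by apply/selectedP; exists t.
Qed.

(** By [false_prop_attained] the infimum runs over finitely many values, so it is a minimum and is
    at most [alpha] exactly when some value is. *)
Lemma inf_false_prop_le s e j :
  (inf [set false_prop s e t | t in [set t | t <= s (rshift ncal j)]] <= alpha)
  = selected s e j.
Proof.
set A := [set _ | _ in _].
have lbA : lbound A 0 by move=> _ [t _ <-]; exact: false_prop_ge0.
apply/idP/idP => [|/selectedP[t tj]].
  apply: contraTT => /existsPn nsel.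
  pose i0 : 'I_(ncal + ntest) := rshift ncal j.
  have i0P : s i0 <= s (rshift ncal j) by [].
  case: (Order.TotalTheory.arg_minP (fun i => false_prop s e (s i)) (i0 := i0)
    (P := fun i => s i <= s (rshift ncal j)) i0P) => i ij imin.
  have := nsel i; rewrite ij/= -!ltNge => /lt_le_trans; apply.
  apply: lb_le_inf; first by exists (false_prop s e (s i0)), (s i0).
  move=> _ [t tj <-]; have [k [_ kj <-]] := false_prop_attained e tj.
  exact: imin.
by apply: le_trans; apply: ge_inf; [exists 0 | exists t].
Qed.

(** Scores enter only through their pairwise order, as thresholds are themselves scores. This leaves
    finitely many cases, which yields measurability later. *)
Lemma eq_false_share s s' e e' j :
  (forall i k, (s i <= s k) = (s' i <= s' k)) -> e =1 e' ->
  false_share s e j = false_share s' e' j.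
Proof.
move=> ss' ee'.
have QE i : false_prop s e (s i) = false_prop s' e' (s' i).
  rewrite /false_prop; congr (_ * (_ + _)%N%:R / (_ * (maxn _ _)%:R)).
    by apply: eq_bigr => l _; rewrite ss' ee'.
  by apply: eq_bigr => l _; rewrite ss'.
have selE l : selected s e l = selected s' e' l.
  by apply: eq_existsb => i; rewrite ss' QE.
by rewrite /false_share /num_selected selE ee'; under eq_bigr do rewrite selE.
Qed.

Lemma false_share_ge0 s e j : 0 <= false_share s e j.
Proof. by rewrite divr_ge0. Qed.

(** * Exchanging one test point with the calibration points *)

Section swap.
Variables (s : 'I_(ncal + ntest) -> R) (e : 'I_(ncal + ntest) -> bool).
Variable j : 'I_ntest.

(** [None] leaves [j] in place, so [option 'I_ncal] indexes all [ncal.+1] arrangements. *)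
Definition swap_pos (o : option 'I_ncal) : 'I_(ncal + ntest) :=
  if o is Some i then lshift ntest i else rshift ncal j.

Definition swap (o : option 'I_ncal) : 'S_(ncal + ntest) :=
  tperm (rshift ncal j) (swap_pos o).

Lemma swap_test o : swap o (rshift ncal j) = swap_pos o.
Proof. exact: tpermL. Qed.

Lemma swap_other_test o l : l != j -> swap o (rshift ncal l) = rshift ncal l.
Proof.
move=> lj; rewrite tpermD//; first by rewrite (inj_eq (@rshift_inj _ _)) eq_sym.
by case: o => [i|]; rewrite /= ?eq_lrshift// (inj_eq (@rshift_inj _ _)) eq_sym.
Qed.

Lemma sum_swap_cal (B : 'I_(ncal + ntest) -> nat) o :
  (\sum_(i < ncal) B (swap o (lshift ntest i)) + B (swap_pos o) =
   \sum_(o' : option 'I_ncal) B (swap_pos o'))%N.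
Proof.
(* Transposing [None] and [o] in the index set mirrors [swap o] on positions: the [None] term
   becomes the point moved to place [j]. *)
rewrite (reindex_inj (@perm_inj _ (tperm None o)))/=.
rewrite sum_option/= tpermL addnC; congr addn; apply: eq_bigr => i _.
case: o => [k|] /=; last by rewrite /swap /= !tperm1 !perm1.
rewrite /swap; case: (eqVneq i k) => [->|ik].
  by rewrite !tpermR.
rewrite !tpermD//= ?eq_rlshift//; last by rewrite eq_sym.
by rewrite (inj_eq (@lshift_inj _ _)) eq_sym.
Qed.

Lemma sum_false_share_swap : 0 <= alpha ->
  \sum_(o : option 'I_ncal) false_share (s \o swap o) (e \o swap o) j
  <= alpha * (ncal.+1%:R / ntest%:R).
Proof.
move=> alpha0.
pose sel o := selected (s \o swap o) (e \o swap o).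
pose K := [set o | sel o j && e (swap_pos o)]%SET.
pose errors t :=
  (\sum_(o' : option 'I_ncal) ((t <= s (swap_pos o'))%R && e (swap_pos o')))%N.
pose others t := (\sum_(l < ntest | l != j) (t <= s (rshift ncal l))%R)%N.
have nselE t o : t <= s (swap_pos o) ->
    (\sum_(l < ntest) (t <= (s \o swap o) (rshift ncal l))%R)%N = (others t).+1.
  move=> to; rewrite (bigD1 j)//= swap_test to; congr _.+1.
  by apply: eq_bigr => l lj; rewrite swap_other_test.
(* The [+ 1] in the numerator stands for the error now at place [j], which completes the calibration
   count to all [ncal.+1] exchanged points; the right-hand side no longer depends on [o]. *)
have QE t o : e (swap_pos o) -> t <= s (swap_pos o) ->
    false_prop (s \o swap o) (e \o swap o) t =
    (ncal.+1%:R^-1 * (errors t)%:R) / (ntest%:R^-1 * (others t).+1%:R).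
  move=> eo to; rewrite /false_prop nselE//= (maxn_idPl _)//.
  rewrite /errors -(sum_swap_cal (fun i => (t <= s i)%R && e i) o).
  by rewrite to eo.
(* Where [j] is not selected, the value 0 of [tau] is a dummy. *)
have /choice[tau tauP] : forall o, exists t, o \in K ->
    [/\ t <= s (swap_pos o), false_prop (s \o swap o) (e \o swap o) t <= alpha &
        forall l, sel o l = (t <= (s \o swap o) (rshift ncal l))].
  move=> o; case: (boolP (sel o j)) => [/selected_threshold[t [+ ? ?]]|nsel].
    by rewrite /= swap_test => to; exists t.
  by exists 0; rewrite inE (negbTE nsel).
(* If [K] is empty, every share vanishes and [0 <= alpha] suffices. *)
case: (pickP (mem K)) => [ o' o'K|K0]; last first.
  rewrite big1 ?mulr_ge0// => o _; rewrite /false_share /= swap_test.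
  have /negbT : (o \in K) = false by exact: K0.
  by rewrite inE => /negbTE ->; rewrite mul0r.
case: (Order.TotalTheory.arg_minP tau (P := mem K) o'K) => o0 o0K tau_min.
have eK o : o \in K -> e (swap_pos o) by rewrite inE => /andP[].
have tauK o : o \in K -> tau o0 <= s (swap_pos o).
  by move=> oK; case: (tauP o oK) => + _ _; apply: le_trans (tau_min _ oK).
(* Points selected under [o] score at least [tau o], hence at least [tau o0]. Conversely [QE]
   carries the bound at [tau o0] from [o0] to [o], so everything above [tau o0] is selected. *)
have numE o : o \in K ->
    num_selected (s \o swap o) (e \o swap o) = (others (tau o0)).+1.
  move=> oK; rewrite -(nselE _ _ (tauK _ oK)); apply: eq_bigr => l _.
  congr nat_of_bool; apply/idP/idP.
    rewrite -/(sel o l); case: (tauP o oK) => _ _ ->.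
    exact: le_trans (tau_min _ oK).
  move=> lt; apply/selectedP; exists (tau o0) => //.
  case: (tauP _ o0K) => to0 Q0 _.
  by rewrite QE ?tauK ?eK// -(QE _ o0) ?eK.
have -> : \sum_(o : option 'I_ncal) false_share (s \o swap o) (e \o swap o) j =
    #|K|%:R / (others (tau o0)).+1%:R.
  rewrite (bigID (mem K))/= [X in _ + X]big1 ?addr0; last first.
    move=> o; rewrite inE /false_share /= swap_test => /negbTE ->.
    by rewrite mul0r.
  rewrite (eq_bigr (fun=> (others (tau o0)).+1%:R^-1)).
    by rewrite sumr_const mulr_natl.
  move=> o oK; rewrite /false_share numE// (maxn_idPl _)//= swap_test.
  by move: oK; rewrite inE => ->; rewrite mul1r.
(* Each arrangement in [K] contributes its own point, an error scoring at least [tau o0]. *)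
have KC : (#|K| <= errors (tau o0))%N.
  rewrite -sum1_card /errors [leqRHS](bigID (mem K))/= -[leqLHS]addn0 leq_add//.
  by apply: leq_sum => o oK; rewrite tauK ?eK.
have : (ncal.+1%:R^-1 * (errors (tau o0))%:R) /
    (ntest%:R^-1 * (others (tau o0)).+1%:R) <= alpha.
  by case: (tauP _ o0K) => to0 Q0 _; rewrite -(QE _ o0) ?eK.
have nt0 : (0 : R) < ntest%:R by rewrite ltr0n (leq_ltn_trans _ (ltn_ord j)).
rewrite ler_pdivrMr ?mulr_gt0 ?invr_gt0// ler_pdivrMl// mulrCA => QQ.
rewrite ler_pdivrMr// -!mulrA; apply: le_trans QQ.
by rewrite ler_nat.
Qed.

End swap.
End scored_sample.

(** * Measurability and the change of variables under exchangeability *)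

Lemma finite_fiber_measurable {d d'} {T : measurableType d}
    {U : measurableType d'} {C : finType} (c : T -> C) (g : T -> U) :
  (forall a, measurable (c @^-1` [set a])) ->
  (forall x y, c x = c y -> g x = g y) -> measurable_fun [set: T] g.
Proof.
move=> mc gc _ B _; rewrite setTI.
rewrite (_ : g @^-1` B = \bigcup_(a in [set c x | x in g @^-1` B]) c @^-1` [set a]).
  by apply: fin_bigcup_measurable; [exact: finite_finset|move=> a _; exact: mc].
apply/seteqP; split=> [x Bx|x [_ [y By <-] /= /gc xy]].
  by exists (c x); first exists x.
by rewrite /= xy.
Qed.

(** The code [c] records all pairwise score comparisons and all error indicators. It has finitely
    many values and measurable fibers, and by [eq_false_share] it determines the share. *)
Lemma measurable_false_share {R : realType} {ncal ntest : nat} {d}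
    {T : measurableType d} (alpha : R)
    (s : 'I_(ncal + ntest) -> T -> R) (e : 'I_(ncal + ntest) -> T -> bool)
    (j : 'I_ntest) :
  (forall i, measurable_fun [set: T] (s i)) ->
  (forall i, measurable_fun [set: T] (e i)) ->
  measurable_fun [set: T] (fun x => false_share alpha (s^~ x) (e^~ x) j).
Proof.
move=> ms me.
pose c x := ([ffun ik => s ik.1 x <= s ik.2 x], [ffun i => e i x])
  : {ffun 'I_(ncal + ntest) * 'I_(ncal + ntest) -> bool} *
    {ffun 'I_(ncal + ntest) -> bool}.
apply: (@finite_fiber_measurable _ _ _ _ _ c) => [[a b]|x y [/ffunP sxy /ffunP exy]].
  rewrite (_ : c @^-1` _ =
    (\bigcap_(ik in [set: 'I_(ncal + ntest) * 'I_(ncal + ntest)])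
       (fun x => s ik.1 x <= s ik.2 x) @^-1` [set a ik]) `&`
    \bigcap_(i in [set: 'I_(ncal + ntest)]) e i @^-1` [set b i]).
    apply: measurableI; apply: fin_bigcap_measurable => // i _;
      rewrite -[X in measurable X]setTI.
      exact: measurable_fun_ler.
    exact: me.
  apply/seteqP; split=> [x [/ffunP ax /ffunP bx]|x [ax bx]].
    by split=> i _ /=; [have := ax i|have := bx i]; rewrite ffunE.
  by congr pair; apply/ffunP => i; rewrite ffunE; [exact: ax|exact: bx].
apply: eq_false_share => [i k|i].
  by have := sxy (i, k); rewrite !ffunE.
by have := exy i; rewrite !ffunE.
Qed.

(** Both integrals are integrals of [g] against pushforward measures, which exchangeability makes
    equal. *)
Lemma ge0_integral_exchangeable {R : realType} {d dG dV}
    {Omega : measurableType d} {P : probability Omega R}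
    {TG : measurableType dG} {V : measurableType dV} {n : nat}
    (G : Omega -> TG) (Z : 'I_n -> Omega -> V) (sigma : 'S_n)
    (g : TG * n.-tuple V -> \bar R) :
  measurable_fun [set: Omega] G -> (forall i, measurable_fun [set: Omega] (Z i)) ->
  exchangeable_given P G Z ->
  measurable_fun [set: TG * n.-tuple V] g -> (forall u, 0 <= g u)%E ->
  (\int[P]_w g (G w, [tuple Z (sigma i) w | i < n]) =
   \int[P]_w g (G w, [tuple Z i w | i < n]))%E.
Proof.
move=> mG mZ exch mg g0.
have mphi (f : 'I_n -> 'I_n) :
    measurable_fun [set: Omega] (fun w => (G w, [tuple Z (f i) w | i < n])).
  apply: measurable_fun_pair => //; apply/measurable_fun_tnthP => i.
  by rewrite [X in measurable_fun _ X](_ : _ = Z (f i))//; apply/funext => w /=;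
     rewrite tnth_mktuple.
have intE f := @ge0_integral_pushforward _ _ _ _ R _ (mphi f) P setT g measurableT mg
  (fun u _ => g0 u).
rewrite -(intE sigma) -(intE id).
by apply: eq_measure_integral => U mU _; exact: exch.
Qed.

Lemma measurable_score {R : realType} {p : nat} {d dtrain}
    {T : measurableType d} {Train : measurableType dtrain}
    (S : Train -> p.-tuple R -> R) (D : T -> Train) (x : T -> p.-tuple R) :
  measurable_fun [set: Train * p.-tuple R] (fun u => S u.1 u.2) ->
  measurable_fun [set: T] D -> measurable_fun [set: T] x ->
  measurable_fun [set: T] (fun t => S (D t) (x t)).
Proof.
by move=> mS mD mx; exact: (measurableT_comp mS (measurable_fun_pair mD mx)).
Qed.

Lemma measurable_max_score {R : realType} {p : nat} {d dtrain}
    {T : measurableType d} {Train : measurableType dtrain}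
    (S : nat -> Train -> p.-tuple R -> R) (D : T -> Train) (x : T -> p.-tuple R) :
  (forall k, k \in [:: 1; 2]%N ->
    measurable_fun [set: Train * p.-tuple R] (fun u => S k u.1 u.2)) ->
  measurable_fun [set: T] D -> measurable_fun [set: T] x ->
  measurable_fun [set: T] (fun t => max_score (fun k => S k (D t)) (x t)).
Proof.
move=> mS mD mx.
by apply: measurable_maxr; apply: (measurable_score (mS _ _)).
Qed.

Lemma measurable_argmax_class {R : realType} {p : nat} {d dtrain}
    {T : measurableType d} {Train : measurableType dtrain}
    (S : nat -> Train -> p.-tuple R -> R) (D : T -> Train) (x : T -> p.-tuple R) :
  (forall k, k \in [:: 1; 2]%N ->
    measurable_fun [set: Train * p.-tuple R] (fun u => S k u.1 u.2)) ->
  measurable_fun [set: T] D -> measurable_fun [set: T] x ->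
  measurable_fun [set: T] (fun t => argmax_class (fun k => S k (D t)) (x t)).
Proof.
move=> mS mD mx.
apply: measurable_fun_ifT => //.
by apply: measurable_fun_ler; apply: (measurable_score (mS _ _)).
Qed.

(** [argmax_class] is never 0, so a nonzero prediction means selection; the denominator is common to
    all [j], so the proportion splits into shares. *)
Lemma false_selection_proportionE {R : realType} {p ncal ntest : nat}
    (alpha : R) (s : nat -> p.-tuple R -> R)
    (x : 'I_(ncal + ntest) -> p.-tuple R) (y : 'I_(ncal + ntest) -> nat) :
  false_selection_proportion
    (Yhat alpha s (fun i : 'I_ncal => x (lshift ntest i))
       (fun i : 'I_ncal => y (lshift ntest i)) (fun j : 'I_ntest => x (rshift ncal j)))
    (fun j : 'I_ntest => y (rshift ncal j)) =
  \sum_(j < ntest) false_share alpha (fun i => max_score s (x i))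
                     (fun i => argmax_class s (x i) != y i) j.
Proof.
set sc := fun i => max_score s (x i); set er := fun i => argmax_class s (x i) != y i.
have YhatE j : Yhat alpha s (fun i : 'I_ncal => x (lshift ntest i))
    (fun i : 'I_ncal => y (lshift ntest i)) (fun j : 'I_ntest => x (rshift ncal j)) j =
    (argmax_class s (x (rshift ncal j)) * selected alpha sc er j)%N.
  by congr (_ * nat_of_bool _)%N; exact: (@inf_false_prop_le _ _ _ alpha sc er j).
have selE j : (argmax_class s (x (rshift ncal j)) * selected alpha sc er j != 0)%N =
    selected alpha sc er j.
  by rewrite /argmax_class; case: ifP; case: selected.
rewrite /false_selection_proportion.
under eq_bigr do rewrite YhatE selE.
under [in X in _ / X]eq_bigr do rewrite YhatE selE.
rewrite natr_sum mulr_suml; apply: eq_bigr => j _.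
rewrite /false_share /num_selected; congr ((nat_of_bool _)%:R / _).
by case: selected; rewrite ?andbF// muln1 andbT.
Qed.

(** * Integration of the pointwise bound over the data *)

Theorem theorem2 (R : realType)
  (d : measure_display) (Omega : measurableType d) (P : probability Omega R)
  (dtrain : measure_display) (Train : measurableType dtrain)
  (Dtrain : Omega -> Train) (mDtrain : measurable_fun [set: Omega] Dtrain)
  (p ncal ntest : nat)
  (X : 'I_(ncal + ntest) -> Omega -> p.-tuple R)
  (mX : forall i, measurable_fun [set: Omega] (X i))
  (Y : 'I_(ncal + ntest) -> Omega -> nat)
  (mY : forall i, measurable_fun [set: Omega] (Y i))
  (Y12 : forall i w, Y i w \in [:: 1; 2]%N)
  (S : nat -> Train -> p.-tuple R -> R)
  (mS : forall k, k \in [:: 1; 2]%N ->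
    measurable_fun [set: Train * p.-tuple R] (fun u => S k u.1 u.2))
  (S_sum1 : forall D x, S 1%N D x + S 2%N D x = 1)
  (exch : exchangeable_given P Dtrain (fun i w => (X i w, Y i w)))
  (pi_cal pi_test : R) (F f : nat -> nat -> R -> R)
  (F_density : forall j k, j \in [:: 1; 2]%N -> k \in [:: 1; 2]%N ->
    cdf_with_density (F j k) (f j k))
  (mixture_cal : two_class_mixture P
    (fun i : 'I_ncal => Y (lshift ntest i))
    (fun k (i : 'I_ncal) w => S k (Dtrain w) (X (lshift ntest i) w)) pi_cal F)
  (mixture_test : two_class_mixture P
    (fun j : 'I_ntest => Y (rshift ncal j))
    (fun k (j : 'I_ntest) w => S k (Dtrain w) (X (rshift ncal j) w)) pi_test F)
  (pi_eq : pi_test = pi_cal)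
  (F_separated : exists x0 x1 : R,
    [/\ x0 <> x1, F 1%N 1%N x0 <> F 2%N 1%N x0 & F 1%N 1%N x1 <> F 2%N 1%N x1])
  (alpha : R) (alpha_ge0 : 0 <= alpha) :
  ('E_P[fun w => false_selection_proportion
          (Yhat alpha (fun k => S k (Dtrain w))
            (fun i : 'I_ncal => X (lshift ntest i) w)
            (fun i : 'I_ncal => Y (lshift ntest i) w)
            (fun j : 'I_ntest => X (rshift ncal j) w))
          (fun j : 'I_ntest => Y (rshift ncal j) w)] <= alpha%:E)%E.
Proof.
(* The share becomes a function of the training data and the sample tuple, the form to which
   exchangeability applies; [h] reorders the sample. *)
pose data (h : 'I_(ncal + ntest) -> 'I_(ncal + ntest)) w :=
  (Dtrain w, [tuple (X (h i) w, Y (h i) w) | i < (ncal + ntest)]).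
pose score (u : Train * (ncal + ntest).-tuple (p.-tuple R * nat)) i :=
  max_score (fun k => S k u.1) (tnth u.2 i).1.
pose err (u : Train * (ncal + ntest).-tuple (p.-tuple R * nat)) i :=
  argmax_class (fun k => S k u.1) (tnth u.2 i).1 != (tnth u.2 i).2.
pose share j u := false_share alpha (score u) (err u) j.
have scoreE h w : score (data h w) = score (data id w) \o h.
  by apply/funext => i; rewrite /score /= !tnth_mktuple.
have errE h w : err (data h w) = err (data id w) \o h.
  by apply/funext => i; rewrite /err /= !tnth_mktuple.
have mZ i : measurable_fun [set: Omega] (fun w => (X i w, Y i w)).
  exact: measurable_fun_pair.
have mdata h : measurable_fun [set: Omega] (data h).
  apply: measurable_fun_pair => //; apply/measurable_fun_tnthP => i.
  rewrite [X in measurable_fun _ X](_ : _ = (fun w => (X (h i) w, Y (h i) w)))//.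
  by apply/funext => w /=; rewrite tnth_mktuple.
have mshare j : measurable_fun setT (share j).
  have mcoord i : measurable_fun setT
      (fun u : Train * (ncal + ntest).-tuple (p.-tuple R * nat) => tnth u.2 i).
    exact: measurableT_comp (measurable_tnth i) measurable_snd.
  have mx i := measurableT_comp measurable_fst (mcoord i).
  have my i := measurableT_comp measurable_snd (mcoord i).
  apply: (@measurable_false_share _ _ _ _ _ alpha (fun i u => score u i)
    (fun i u => err u i)) => i.
    exact: (measurable_max_score mS measurable_fst (mx i)).
  apply: measurable_neg; apply: measurable_fun_eqn.
    exact: (measurable_argmax_class mS measurable_fst (mx i)).
  exact: my.
have share_ge0 j u : (0 <= (share j u)%:E)%E by rewrite lee_fin false_share_ge0.
have mshareE j h : measurable_fun [set: Omega] (fun w => (share j (data h w))%:E).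
  by apply/measurable_EFinP; exact: measurableT_comp (mshare j) (mdata h).
have int_share j : (\int[P]_w (share j (data id w))%:E <= (alpha / ntest%:R)%:E)%E.
  have int_swap o : (\int[P]_w (share j (data (swap j o) w))%:E =
                     \int[P]_w (share j (data id w))%:E)%E.
    apply: (ge0_integral_exchangeable (swap j o) (g := fun u => (share j u)%:E)
      mDtrain mZ exch) => //.
    exact/measurable_EFinP.
  (* The factor is the number of arrangements: the [ncal.+1] equal integrals add up to the integral
     of the sum bounded by [sum_false_share_swap]. *)
  rewrite -(@lee_pmul2l _ ncal.+1%:R%:E)//.
  have -> : (ncal.+1%:R%:E * \int[P]_w (share j (data id w))%:E =
      \int[P]_w (\sum_(o : option 'I_ncal) (share j (data (swap j o) w))%:E))%E.
    rewrite ge0_integral_sum//.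
    under eq_bigr do rewrite int_swap.
    by rewrite sumr_const card_option card_ord; exact: mule_natl.
  apply: (@le_trans _ _ (\int[P]_w (cst (ncal.+1%:R * (alpha / ntest%:R))%:E w))%E).
    apply: ge0_le_integral => //.
    - by move=> w _; exact: sume_ge0.
    - exact: emeasurable_sum.
    - move=> w _; rewrite /= sumEFin lee_fin mulrCA.
      apply: le_trans
        (sum_false_share_swap (score (data id w)) (err (data id w)) j alpha_ge0).
      by apply: ler_sum => o _; rewrite /share scoreE errE.
  by rewrite integral_cst// [X in (_ * X)%E](@probability_setT _ _ _ P) mule1 EFinM.
have fspE w : false_selection_proportion
    (Yhat alpha (fun k => S k (Dtrain w))
      (fun i : 'I_ncal => X (lshift ntest i) w)
      (fun i : 'I_ncal => Y (lshift ntest i) w)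
      (fun j : 'I_ntest => X (rshift ncal j) w))
    (fun j : 'I_ntest => Y (rshift ncal j) w) = \sum_(j < ntest) share j (data id w).
  rewrite (false_selection_proportionE alpha _ (X^~ w) (Y^~ w)).
  apply: eq_bigr => j _; congr (false_share _ _ _ _).
    by apply/funext => i; rewrite /score /= tnth_mktuple.
  by apply/funext => i; rewrite /err /= tnth_mktuple.
rewrite unlock; under eq_integral do rewrite fspE -sumEFin.
rewrite ge0_integral_sum//.
apply: (@le_trans _ _ (\sum_(j < ntest) (alpha / ntest%:R)%:E)%E); first exact: lee_sum.
rewrite sumEFin lee_fin sumr_const card_ord -[leLHS]mulr_natr -mulrA.
(* Without test points the claim reduces to [0 <= alpha]. *)
have [->|ntest_gt0] := posnP ntest; first by rewrite mulr0 mulr0.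
by rewrite mulVf ?mulr1// pnatr_eq0 -lt0n.
Qed.
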